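(* Let $G$ be Hofstadter's G-sequence and let $W$ be the Wythoff swap sequence (both defined below). Define $\overline{W}(n)=\frac{1}{n+1}\sum_{i=0}^{n}W(i)$ for $n\ge 0$. Then $\overline{W}(n)=G(n)$ for all $n\ge 0$.
   Context: Hofstadter's G-sequence is defined by $G(0)=0$, $G(1)=1$, and $G(n)=n-G(G(n-1))$ for $n\ge 2$. Let $\varphi=(1+\sqrt5)/2$. The lower and upper Wythoff sequences are $L(n)=\lfloor n\varphi\rfloor$ and $U(n)=\lfloor n\varphi^2\rfloor$ for $n\ge 1$; the sets $\{L(n):n\ge1\}$ and $\{U(n):n\ge1\}$ are disjoint with union the set of positive integers. The Wythoff swap sequence $W$ on the nonnegative integers is defined by $W(0)=0$ and $W(L(n))=U(n)$, $W(U(n))=L(n)$ for all $n\ge 1$. *)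

(* Defs.v *)
From Stdlib Require Import Reals Lra Lia Psatz ZArith Arith ClassicalEpsilon.
Open Scope R_scope.

(* Subtraction on [nat] is truncated, but the recurrence forces G n <= n, hence
   G (G (n - 1)) <= n, so it never truncates. *)
Definition is_hofstadter_G (G : nat -> nat) : Prop :=
  G 0%nat = 0%nat /\ G 1%nat = 1%nat /\
  forall n : nat, (2 <= n)%nat -> G n = (n - G (G (n - 1)))%nat.

Definition phi : R := (1 + sqrt 5) / 2.

(* [Int_part] is the floor function; the arguments below are nonnegative, so
   [Z.to_nat] loses nothing. *)
Definition wythoff_lower (n : nat) : nat := Z.to_nat (Int_part (INR n * phi)).
Definition wythoff_upper (n : nat) : nat := Z.to_nat (Int_part (INR n * phi ^ 2)).

Definition is_wythoff_swap (W : nat -> nat) : Prop :=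
  W 0%nat = 0%nat /\
  forall n : nat, (1 <= n)%nat ->
    W (wythoff_lower n) = wythoff_upper n /\
    W (wythoff_upper n) = wythoff_lower n.

(* [sum_f_R0 f n] is f 0 + ... + f n. *)
Definition average (W : nat -> nat) (n : nat) : R :=
  / INR (n + 1) * sum_f_R0 (fun i => INR (W i)) n.

Lemma hofstadter_G_exists : exists G, is_hofstadter_G G.
Proof.
  pose (f := fix f (k n : nat) {struct k} : nat :=
    match k, n with
    | O, _ => O
    | _, O => O
    | S k', S m => (n - f k' (f k' m))%nat
    end).
  assert (fle : forall k n, (f k n <= n)%nat)
    by (intros [|k] [|n]; cbn -[Nat.sub]; lia).
  assert (fst : forall k l n, (n <= k)%nat -> (n <= l)%nat -> f k n = f l n).
  { induction k as [|k IH]; intros [|l] [|n] Hk Hl; try lia; try reflexivity.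
    cbn -[Nat.sub]. rewrite (IH l n) by lia.
    rewrite (IH l (f l n)); [reflexivity| |]; pose proof (fle l n); lia. }
  exists (fun n => f n n). split; [reflexivity|split; [reflexivity|]].
  intros [|n] Hn; [lia|]. replace (S n - 1)%nat with n by lia.
  change (f (S n) (S n)) with (S n - f n (f n n))%nat.
  rewrite (fst n (f n n) (f n n)); [reflexivity|apply fle|lia].
Qed.

Lemma phi_sqr : phi ^ 2 = phi + 1.
Proof.
  unfold phi. assert (H : sqrt 5 * sqrt 5 = 5) by (apply sqrt_sqrt; lra). nra.
Qed.

Lemma phi_bounds : 1 < phi < 2.
Proof.
  assert (H0 := sqrt_pos 5).
  assert (H : sqrt 5 * sqrt 5 = 5) by (apply sqrt_sqrt; lra).
  unfold phi; split; nra.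
Qed.

Lemma floor_nat_spec (x : R) : 0 <= x ->
  INR (Z.to_nat (Int_part x)) <= x < INR (Z.to_nat (Int_part x)) + 1.
Proof.
  intros Hx. destruct (base_Int_part x) as [H1 H2].
  assert (Hz : (0 <= Int_part x)%Z).
  { assert (IZR (-1) < IZR (Int_part x)) as H by lra. apply lt_IZR in H. lia. }
  rewrite INR_IZR_INZ, Z2Nat.id by exact Hz. lra.
Qed.

Lemma wythoff_lower_spec (n : nat) :
  INR (wythoff_lower n) <= INR n * phi < INR (wythoff_lower n) + 1.
Proof.
  apply floor_nat_spec. pose proof (pos_INR n). pose proof phi_bounds. nra.
Qed.

Lemma wythoff_upper_spec (n : nat) :
  INR (wythoff_upper n) <= INR n * phi ^ 2 < INR (wythoff_upper n) + 1.
Proof.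
  apply floor_nat_spec. pose proof (pos_INR n). pose proof phi_bounds. nra.
Qed.

Lemma phi_irrational (m k : nat) : (1 <= m)%nat -> INR m * phi <> INR k.
Proof.
  intros Hm E.
  assert (Q : forall m k : nat, (1 <= m)%nat -> (k * k <> k * m + m * m)%nat).
  { clear. intros m; induction m as [m IH] using lt_wf_ind. intros k Hm E.
    apply (IH (k - m)%nat) with (k := m); nia. }
  apply (Q m k Hm), INR_eq. rewrite plus_INR, !mult_INR, <- E.
  pose proof phi_sqr. nra.
Qed.

Lemma wythoff_lower_upper_disjoint (m n : nat) : (1 <= m)%nat ->
  wythoff_lower m <> wythoff_upper n.
Proof.
  intros Hm E.
  pose proof (wythoff_lower_spec m) as H1. pose proof (wythoff_upper_spec n) as H2.
  rewrite <- E in H2. remember (wythoff_lower m) as k eqn:Ek. clear E Ek.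
  pose proof phi_sqr as P. pose proof phi_bounds as B.
  assert (I : INR m * phi <> INR k) by (apply phi_irrational; exact Hm).
  rewrite P in H2.
  assert (D : INR k < INR m * phi) by lra.
  assert (P1 : INR m * phi * (phi - 1) = INR m)
    by (replace (INR m * phi * (phi - 1)) with (INR m * (phi ^ 2 - phi)) by ring; rewrite P; ring).
  assert (P2 : INR n * (phi + 1) * (2 - phi) = INR n)
    by (replace (INR n * (phi + 1) * (2 - phi)) with (INR n * (2 + phi - phi ^ 2)) by ring; rewrite P; ring).
  assert (Q1 := Rmult_lt_compat_r (phi - 1) _ _ ltac:(lra) D).
  assert (Q2 := Rmult_le_compat_r (2 - phi) _ _ ltac:(lra) (proj1 H2)).
  assert (Q3 := Rmult_lt_compat_r (phi - 1) _ _ ltac:(lra) (proj2 H1)).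
  assert (Q4 := Rmult_lt_compat_r (2 - phi) _ _ ltac:(lra) (proj2 H2)).
  assert (A1 : INR k < INR (m + n)) by (rewrite plus_INR; lra).
  assert (A2 : INR (m + n) < INR (S k)) by (rewrite plus_INR, S_INR; lra).
  apply INR_lt in A1. apply INR_lt in A2. lia.
Qed.

Lemma wythoff_lower_inj (m n : nat) : wythoff_lower m = wythoff_lower n -> m = n.
Proof.
  intros E. pose proof (wythoff_lower_spec m). pose proof (wythoff_lower_spec n).
  rewrite E in *. pose proof phi_bounds.
  destruct (Nat.lt_trichotomy m n) as [L|[L|L]]; [|exact L|];
  apply le_INR in L; rewrite S_INR in L; nra.
Qed.

Lemma wythoff_upper_inj (m n : nat) : wythoff_upper m = wythoff_upper n -> m = n.
Proof.
  intros E. pose proof (wythoff_upper_spec m). pose proof (wythoff_upper_spec n).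
  rewrite E, phi_sqr in *. pose proof phi_bounds.
  destruct (Nat.lt_trichotomy m n) as [L|[L|L]]; [|exact L|];
  apply le_INR in L; rewrite S_INR in L; nra.
Qed.

Lemma wythoff_swap_exists : exists W, is_wythoff_swap W.
Proof.
  assert (L0 : wythoff_lower 0 = 0%nat).
  { pose proof (wythoff_lower_spec 0) as H. simpl INR in H at 2 3.
    apply INR_eq. pose proof (pos_INR (wythoff_lower 0)). simpl (INR 0). lra. }
  assert (U0 : wythoff_upper 0 = 0%nat).
  { pose proof (wythoff_upper_spec 0) as H. simpl INR in H at 2 3.
    apply INR_eq. pose proof (pos_INR (wythoff_upper 0)). simpl (INR 0). lra. }
  assert (T : forall k, exists w, forall m,
    (k = wythoff_lower m -> w = wythoff_upper m) /\
    (k = wythoff_upper m -> w = wythoff_lower m)).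
  { intros k.
    destruct (excluded_middle_informative (exists m, k = wythoff_lower m)) as [[m ->]|N].
    - exists (wythoff_upper m). intros m'. split; intros E.
      + apply wythoff_lower_inj in E. now subst.
      + destruct m as [|m].
        * rewrite L0, <- U0 in E. apply wythoff_upper_inj in E. subst. congruence.
        * exfalso. revert E. apply wythoff_lower_upper_disjoint. lia.
    - destruct (excluded_middle_informative (exists m, k = wythoff_upper m)) as [[m ->]|N'].
      + exists (wythoff_lower m). intros m'. split; intros E.
        * exfalso. apply N. now exists m'.
        * apply wythoff_upper_inj in E. now subst.
      + exists 0%nat. intros m. split; intros E; exfalso; eauto. }
  exists (fun k => proj1_sig (constructive_indefinite_description _ (T k))).
  split.
  - destruct (constructive_indefinite_description _ (T 0%nat)) as [w Hw]. simpl.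
    rewrite (proj1 (Hw 0%nat)); auto.
  - intros n _. split.
    + destruct (constructive_indefinite_description _ (T (wythoff_lower n))) as [w Hw].
      now apply Hw.
    + destruct (constructive_indefinite_description _ (T (wythoff_upper n))) as [w Hw].
      now apply Hw.
Qed.

(* Main.v *)
Require Import Defs.
From Stdlib Require Import Reals Lra Lia Arith.
Open Scope R_scope.

(** [G n] is the floor of [(n + 1) / phi], so [g = G n] is determined by
    [g * phi <= n + 1 < (g + 1) * phi].  Consequently [G] increases by one
    exactly at the lower Wythoff numbers [n = L g], where [W n = n + g], and
    stays constant exactly at the upper ones [n = U m], where [W n = L m = g].
    In both cases [W n = (n + 1) * G n - n * G (n - 1)], and the sum of [W]
    telescopes to [(n + 1) * G n]. *)

Definition is_div_phi (q n : nat) : Prop :=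
  INR q * phi <= INR n < (INR q + 1) * phi.

Lemma is_div_phi_unique (p q n : nat) :
  is_div_phi p n -> is_div_phi q n -> p = q.
Proof.
  intros [H1 H2] [H3 H4]. pose proof phi_bounds.
  destruct (Nat.lt_trichotomy p q) as [L|[L|L]]; [|exact L|];
  apply le_INR in L; rewrite S_INR in L; nra.
Qed.

Lemma is_div_phi_lt (q n : nat) : (1 <= n)%nat -> is_div_phi q n -> (q < n)%nat.
Proof.
  intros Hn [H _]. pose proof phi_bounds. apply le_INR in Hn. simpl in Hn.
  apply INR_lt. pose proof (pos_INR q). nra.
Qed.

(** Floors of quotients by [phi] obey the recurrence of [G]. The floor for [n + 1] is [p] or
    [p + 1], according to the side of [(p + 1) * phi] on which [n + 1] lies. Scaling the bounds by
    [phi] or its inverse shows that [q] is [n - p] in the first case and [n - (p + 1)] in the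
    second. *)
Lemma hofstadter_step (n p q : nat) : (1 <= n)%nat ->
  is_div_phi p n -> is_div_phi q (p + 1) -> is_div_phi (n - q) (n + 1).
Proof.
  intros Hn Hp Hq.
  pose proof (is_div_phi_lt p n Hn Hp) as Hlt.
  pose proof phi_bounds as B. pose proof phi_sqr as P.
  destruct Hp as [p1 p2].
  assert (p1' := Rmult_le_compat_r phi _ _ ltac:(lra) p1).
  replace (INR p * phi * phi) with (INR p * phi ^ 2) in p1' by ring.
  (* The factor [phi - 1] is the inverse of [phi], because [phi ^ 2 - phi = 1]. *)
  assert (p2' := Rmult_lt_compat_r (phi - 1) _ _ ltac:(lra) p2).
  replace ((INR p + 1) * phi * (phi - 1)) with ((INR p + 1) * (phi ^ 2 - phi))
    in p2' by ring.
  rewrite P in p1', p2'.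
  destruct (Rtotal_order (INR n + 1) ((INR p + 1) * phi)) as [C|[C|C]].
  - assert (C' := Rmult_lt_compat_r (phi - 1) _ _ ltac:(lra) C).
    replace ((INR p + 1) * phi * (phi - 1)) with ((INR p + 1) * (phi ^ 2 - phi))
      in C' by ring.
    rewrite P in C'.
    assert (E : q = (n - p)%nat).
    { apply (is_div_phi_unique _ _ (p + 1)); [exact Hq|].
      unfold is_div_phi. rewrite minus_INR, plus_INR by lia. simpl. lra. }
    subst q. replace (n - (n - p))%nat with p by lia.
    unfold is_div_phi. rewrite plus_INR. simpl. lra.
  - exfalso. apply (phi_irrational (p + 1) (n + 1)); [lia|].
    rewrite !plus_INR. simpl. lra.
  - assert (C' := Rmult_lt_compat_r phi _ _ ltac:(lra) C).
    replace ((INR p + 1) * phi * phi) with ((INR p + 1) * phi ^ 2) in C' by ring.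
    rewrite P in C'.
    assert (E : q = (n - (p + 1))%nat).
    { apply (is_div_phi_unique _ _ (p + 1)); [exact Hq|].
      unfold is_div_phi. rewrite minus_INR, plus_INR by lia. simpl. lra. }
    subst q. replace (n - (n - (p + 1)))%nat with (p + 1)%nat by lia.
    unfold is_div_phi. rewrite !plus_INR. simpl. lra.
Qed.

Lemma hofstadter_G_div_phi (G : nat -> nat) : is_hofstadter_G G ->
  forall n : nat, is_div_phi (G n) (n + 1).
Proof.
  intros (G0 & G1 & GS). pose proof phi_bounds as B.
  induction n as [n IH] using lt_wf_ind.
  destruct n as [|[|n]].
  - rewrite G0. unfold is_div_phi. simpl. lra.
  - rewrite G1. unfold is_div_phi. simpl. lra.
  - rewrite GS by lia. replace (S (S n) - 1)%nat with (S n) by lia.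
    assert (Hp := IH (S n) ltac:(lia)).
    replace (S n + 1)%nat with (S (S n)) in Hp by lia.
    apply (hofstadter_step _ (G (S n))); [lia|exact Hp|].
    (* The nested argument [G (S n)] is below [S (S n)] by the induction hypothesis at [S n], so
       strong induction reaches it. *)
    apply IH. apply is_div_phi_lt; [lia|exact Hp].
Qed.

Lemma wythoff_lower_unique (m k : nat) :
  INR k <= INR m * phi < INR k + 1 -> wythoff_lower m = k.
Proof.
  intros H. pose proof (wythoff_lower_spec m).
  assert (A : INR k < INR (S (wythoff_lower m))) by (rewrite S_INR; lra).
  assert (C : INR (wythoff_lower m) < INR (S k)) by (rewrite S_INR; lra).
  apply INR_lt in A. apply INR_lt in C. lia.
Qed.

(** Since [phi ^ 2 = phi + 1], the two products differ by the integer [m], hence so do their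
    floors. *)
Lemma wythoff_upper_lower (m : nat) :
  wythoff_upper m = (wythoff_lower m + m)%nat.
Proof.
  pose proof (wythoff_lower_spec m). pose proof (wythoff_upper_spec m) as H2.
  rewrite phi_sqr in H2.
  assert (A : INR (wythoff_lower m + m) < INR (S (wythoff_upper m)))
    by (rewrite S_INR, plus_INR; lra).
  assert (C : INR (wythoff_upper m) < INR (S (wythoff_lower m + m)))
    by (rewrite S_INR, plus_INR; lra).
  apply INR_lt in A. apply INR_lt in C. lia.
Qed.

(** The telescoping identity, with [p] for [G (n - 1)] and [g] for [G n], arranged so that no
    truncated subtraction occurs. *)
Lemma wythoff_swap_step (W : nat -> nat) (n p g : nat) : is_wythoff_swap W ->
  (1 <= n)%nat -> is_div_phi p n -> is_div_phi g (n + 1) ->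
  (n * p + W n = (n + 1) * g)%nat.
Proof.
  intros [_ HW] Hn Hp Hg.
  pose proof (is_div_phi_lt p n Hn Hp) as Hlt.
  pose proof phi_bounds as B. pose proof phi_sqr as P.
  destruct Hp as [p1 p2]. destruct Hg as [g1 g2].
  rewrite plus_INR in g1, g2. simpl (INR 1) in g1, g2.
  assert (Hpg : g = p \/ g = (p + 1)%nat).
  { assert (A : INR g < INR (p + 2)) by (rewrite plus_INR; simpl; nra).
    assert (C : INR p < INR (g + 1)) by (rewrite plus_INR; simpl; nra).
    apply INR_lt in A. apply INR_lt in C. lia. }
  destruct Hpg as [E|E]; subst g.
  (* No increase: the scaled bounds give [p <= (n - p) * phi < p + 1], so [n] is the upper Wythoff
     number of index [n - p]. *)
  - assert (p1' := Rmult_le_compat_r phi _ _ ltac:(lra) p1).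
    replace (INR p * phi * phi) with (INR p * phi ^ 2) in p1' by ring.
    assert (g2' := Rmult_lt_compat_r (phi - 1) _ _ ltac:(lra) g2).
    replace ((INR p + 1) * phi * (phi - 1)) with ((INR p + 1) * (phi ^ 2 - phi))
      in g2' by ring.
    rewrite P in p1', g2'.
    assert (HL : wythoff_lower (n - p) = p).
    { apply wythoff_lower_unique. rewrite minus_INR by lia. lra. }
    assert (HU : wythoff_upper (n - p) = n) by (rewrite wythoff_upper_lower; lia).
    destruct (HW (n - p)%nat ltac:(lia)) as [_ E].
    rewrite HU, HL in E. rewrite E. ring.
  - rewrite plus_INR in g1. simpl (INR 1) in g1.
    (* Irrationality makes [(p + 1) * phi <= n + 1] strict, so the floor of [(p + 1) * phi] is [n]
       and not [n + 1]. *)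
    assert (I : INR (p + 1) * phi <> INR (n + 1)) by (apply phi_irrational; lia).
    rewrite !plus_INR in I. simpl (INR 1) in I.
    assert (HL : wythoff_lower (p + 1) = n).
    { apply wythoff_lower_unique. rewrite plus_INR. simpl (INR 1). lra. }
    destruct (HW (p + 1)%nat ltac:(lia)) as [E _].
    rewrite wythoff_upper_lower, HL in E. rewrite E. ring.
Qed.

Lemma wythoff_swap_sum (G W : nat -> nat) :
  is_hofstadter_G G -> is_wythoff_swap W ->
  forall n : nat,
    sum_f_R0 (fun i => INR (W i)) n = INR (n + 1) * INR (G n).
Proof.
  intros hG hW. pose proof (hofstadter_G_div_phi G hG) as D.
  induction n as [|n IH].
  - simpl. rewrite (proj1 hW), (proj1 hG). simpl. ring.
  - rewrite tech5, IH, <- !mult_INR, <- plus_INR. f_equal.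
    replace (n + 1)%nat with (S n) by lia.
    apply wythoff_swap_step; [exact hW|lia| |apply D].
    replace (S n) with (n + 1)%nat by lia. apply D.
Qed.

Theorem theorem3 (G W : nat -> nat) (hG : is_hofstadter_G G)
  (hW : is_wythoff_swap W) :
  forall n : nat, average W n = INR (G n).
Proof.
  intros n. unfold average. rewrite (wythoff_swap_sum G W hG hW).
  field. apply not_0_INR. lia.
Qed.
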